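(* Let $\mathcal{I}$ be a nontrivial admissible ideal of subsets of $\mathbb{N}$. For any $(s)=\{s_n\}_{n\in\mathbb{N}}\in\Sigma_{\mathcal{I}}$ and any $A\in\mathcal{T}^{\mathcal{I}}_{(s)}$: (1) $A+x\in\mathcal{T}^{\mathcal{I}}_{(s)}$ for all $x\in\mathbb{R}$, where $A+x=\{a+x:a\in A\}$; (2) $-A\in\mathcal{T}^{\mathcal{I}}_{(s)}$, where $-A=\{-a:a\in A\}$.
   Context: $\mathcal{L}$ is the $\sigma$-algebra of Lebesgue measurable subsets of $\mathbb{R}$ and $\lambda$ is Lebesgue measure on $\mathbb{R}$. An ideal $\mathcal{I}$ of subsets of $\mathbb{N}$ is a nonempty family $\mathcal{I}\subset 2^{\mathbb{N}}$ closed under finite unions and under taking subsets; it is nontrivial if $\mathcal{I}\neq\{\emptyset\}$ and $\mathcal{I}\neq 2^{\mathbb{N}}$, and admissible if it contains all singletons (hence all finite subsets of $\mathbb{N}$). $\mathcal{F}(\mathcal{I})=\{M\subset\mathbb{N}:\mathbb{N}\setminus M\in\mathcal{I}\}$ is the associated filter. A real sequence $\{x_n\}$ is $\mathcal{I}$-convergent to $x_0$, written $\mathcal{I}\text{-}\lim_n x_n=x_0$, if $\{k\in\mathbb{N}:|x_k-x_0|\ge\epsilon\}\in\mathcal{I}$ for every $\epsilon>0$. A real sequence $\{x_n\}$ is $\mathcal{I}$-monotonic increasing if there is a set $\{k_1<k_2<\cdots\}\in\mathcal{F}(\mathcal{I})$ such that $x_{k_i}\le x_{k_{i+1}}$ for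 every $i\in\mathbb{N}$. $\Sigma_{\mathcal{I}}$ denotes the family of all unbounded, $\mathcal{I}$-monotonic increasing sequences of positive reals. For $(s)=\{s_n\}\in\Sigma_{\mathcal{I}}$ and $A\in\mathcal{L}$, a point $p\in\mathbb{R}$ is an $\mathcal{I}_{(s)}$-density point of $A$ if $\mathcal{I}\text{-}\lim_n \frac{\lambda\left(A\cap\left[p-\frac1{s_n},p+\frac1{s_n}\right]\right)}{2/s_n}=1$. $\Phi^{\mathcal{I}}_{(s)}(A)$ is the set of all $\mathcal{I}_{(s)}$-density points of $A$, and $\mathcal{T}^{\mathcal{I}}_{(s)}=\{A\in\mathcal{L}: A\subseteq \Phi^{\mathcal{I}}_{(s)}(A)\}$ (the $\mathcal{I}_{(s)}$-density topology). *)

(* Defs.v *)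
From HB Require Import structures.
From mathcomp Require Import all_boot all_order all_algebra.
From mathcomp Require Import all_classical all_reals all_analysis.
Set Implicit Arguments.
Unset Strict Implicit.
Unset Printing Implicit Defensive.
Import Order.TTheory GRing.Theory Num.Theory.
Import numFieldNormedType.Exports.
Local Open Scope classical_set_scope.
Local Open Scope ring_scope.

Definition is_ideal (I : set (set nat)) : Prop :=
  [/\ I !=set0,
      forall M N, I M -> I N -> I (M `|` N) &
      forall M N, M `<=` N -> I N -> I M].

Definition nontrivial_ideal (I : set (set nat)) : Prop :=
  I <> [set set0] /\ I <> setT.

Definition admissible_ideal (I : set (set nat)) : Prop :=
  forall n, I [set n].

Definition ideal_filter (I : set (set nat)) : set (set nat) :=
  [set M | I (~` M)].

Definition ideal_cvg (R : realType) (I : set (set nat)) (x : R^nat) (l : R) :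
    Prop :=
  forall e : R, 0 < e -> I [set k | e <= `|x k - l|].

(* The set of indices {k_1 < k_2 < ...} is the range of its (strictly
   increasing) enumeration k. *)
Definition ideal_increasing (R : realType) (I : set (set nat)) (x : R^nat) :
    Prop :=
  exists k : nat^nat,
    [/\ increasing_seq k,
        ideal_filter I (range k) &
        forall i, x (k i) <= x (k i.+1)].

Definition Sigma_ideal (R : realType) (I : set (set nat)) : set (R^nat) :=
  [set s : R^nat |
    [/\ forall n, 0 < s n, ~ bounded_fun s & ideal_increasing I s]].

(* The domain of completed_lebesgue_measure: the Caratheodory sigma-algebra of
   the Lebesgue outer measure.  The default sigma-algebra on R is the Borel
   one, which is strictly smaller. *)
Definition lebesgue_measurable (R : realType) : set (set R) :=
  ((@wlength R idfun)^*)%mu.-cara.-measurable.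

(* Taking fine loses nothing: for s n > 0 the measured set is included in a
   bounded interval. *)
Definition density_ratio (R : realType) (s : R^nat) (A : set R) (p : R) :
    R^nat :=
  fun n => fine (@completed_lebesgue_measure R
                   (A `&` `[p - 1 / s n, p + 1 / s n])) / (2 / s n).

Definition density_point (R : realType) (I : set (set nat)) (s : R^nat)
    (A : set R) (p : R) : Prop :=
  ideal_cvg I (density_ratio s A p) 1.

Definition density_points (R : realType) (I : set (set nat)) (s : R^nat)
    (A : set R) : set R :=
  [set p | density_point I s A p].

Definition density_topology (R : realType) (I : set (set nat)) (s : R^nat) :
    set (set R) :=
  [set A | lebesgue_measurable A /\ A `<=` density_points I s A].

(* Main.v *)
Require Import Defs.
From HB Require Import structures.
From mathcomp Require Import all_boot all_order all_algebra.
From mathcomp Require Import all_classical all_reals all_analysis.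
From mathcomp Require Import lra.
Import Order.TTheory GRing.Theory Num.Theory.
Import numFieldNormedType.Exports.
Local Open Scope classical_set_scope.
Local Open Scope ring_scope.

(** Translations and the reflection [a |-> - a] are isometries of the line, and
everything that enters the definition of the density topology is invariant
under an isometry [f] with inverse [g].

The main point is the invariance of Lebesgue outer measure. A nonexpansive map
does not increase it ([le_outer_measure_nonexpansive]): a cover of [A] by
half-open intervals is sent to a cover of the image of [A] by sets, each of
which lies in a closed interval as long as the one it comes from. Applying
this to [f] and to [g] gives equality ([outer_measure_isometry]). Since [f] is
a bijection it commutes with intersections and complements, so it preserves
Caratheodory measurability. Finally [f] carries the interval of radius
[1 / s n] around [p] onto the one around [f p], so the density ratios of the
image of [A] at [f p] are, term by term, those of [A] at [p]
([density_ratio_isometry]): the two sequences have the same limits along the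
ideal. *)

Lemma image_canK {T U : Type} (f : T -> U) (g : U -> T) (A : set U) :
  cancel g f -> f @` (g @` A) = A.
Proof. by move=> gK; rewrite image_comp eq_image_id// => x _; exact: gK. Qed.

Lemma image_can2_preimage {T U : Type} (f : T -> U) (g : U -> T) (A : set T) :
  cancel f g -> cancel g f -> f @` A = g @^-1` A.
Proof.
move=> fK gK; apply/seteqP; split=> [_ [x Ax <-]|y Agy].
  by rewrite /= fK.
by exists (g y).
Qed.

(** For two mutually inverse maps this condition on both of them means that
they are isometries; by itself it is
the half that does not increase outer measures. *)
Definition nonexpansive {R : realType} (f : R -> R) : Prop :=
  forall x y, `|f x - f y| <= `|x - y|.

(** A closed interval is a ball, and a nonexpansive map sends the ball of
center [p] into the ball of the same radius and center [f p]. *)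
Lemma image_itvcc_nonexpansive {R : realType} (f : R -> R) (p r : R) :
  nonexpansive f ->
  f @` `[p - r, p + r] `<=` `[f p - r, f p + r].
Proof.
move=> fne _ [x /= + <-]; rewrite !in_itv/= -!ler_distlC => xpr.
exact: le_trans (fne _ _) xpr.
Qed.

(** On all subsets of [R], [completed_lebesgue_measure] is by definition this
outer measure. *)
Local Notation lambda := (@wlength _ idfun)^*%mu.

(** The image of [`]a, b]] need not be open on the left and closed on the right
(the reflection exchanges the two), but it lies in the ball of
radius [(b - a) / 2] around the image of the midpoint, which has length [b - a]. *)
Lemma le_outer_measure_itvoc_nonexpansive {R : realType} (f : R -> R)
    (a b : R) : nonexpansive f ->
  (lambda (f @` `]a, b]) <= wlength idfun `]a, b])%E.
Proof.
move=> fne; rewrite wlength_itv/= lte_fin; case: ltP => [ab|ba]; last first.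
  by rewrite set_itv_ge ?image_set0 ?outer_measure0// bnd_simp -leNgt.
pose p := (a + b) / 2; pose r := (b - a) / 2.
apply: (@le_trans _ _ (lambda (`[f p - r, f p + r] : set R))).
  apply: le_outer_measure.
  apply: subset_trans (image_itvcc_nonexpansive f p r fne).
  apply: image_subset => x/=; rewrite !in_itv/= /p /r; lra.
have -> : lambda (`[f p - r, f p + r] : set R) = _ := lebesgue_measure_itv _.
rewrite /= lte_fin ltrD2l gtrN; last by rewrite /r; lra.
by rewrite lee_fin /r; lra.
Qed.

(** The images of the half-open intervals of a cover of [A] cover [f @` A], and
the outer measure of each is at most the length of its interval; countable
subadditivity makes up for these images not being half-open intervals. *)
Lemma le_outer_measure_nonexpansive {R : realType} (f : R -> R)
    (A : set R) : nonexpansive f ->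
  (lambda (f @` A) <= lambda A)%E.
Proof.
move=> fne; apply: le_ereal_inf_tmp => _ [F [Fm AF] <-].
apply: (@le_trans _ _ (lambda (\bigcup_k (f @` F k)))).
  by apply: le_outer_measure; rewrite -image_bigcup; exact: image_subset.
apply: (le_trans (outer_measure_sigma_subadditive _ _)).
apply: lee_nneseries => [k _ _|k _]; first exact: outer_measure_ge0.
by have [[a b] _ <-] := Fm k; exact: le_outer_measure_itvoc_nonexpansive.
Qed.

Section isometry.
Context {R : realType} (f g : R -> R).
Hypotheses (fK : cancel f g) (gK : cancel g f).
Hypotheses (f_nonexp : nonexpansive f) (g_nonexp : nonexpansive g).

Let fE (A : set R) : f @` A = g @^-1` A.
Proof. exact: image_can2_preimage. Qed.

Lemma outer_measure_isometry (A : set R) : lambda (f @` A) = lambda A.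
Proof.
apply/eqP; rewrite eq_le le_outer_measure_nonexpansive//=.
rewrite -{1}(image_canK g f A fK).
exact: le_outer_measure_nonexpansive.
Qed.

Lemma image_itvcc_isometry (p r : R) :
  f @` `[p - r, p + r] = `[f p - r, f p + r]%classic.
Proof.
apply/seteqP; split; first exact: image_itvcc_nonexpansive.
rewrite -[X in X `<=` _](image_canK f g _ gK); apply: image_subset.
by have := image_itvcc_nonexpansive g (f p) r g_nonexp; rewrite fK.
Qed.

(** Any test set [X] is the image of [g @` X], so the Caratheodory condition for
[f @` A] at [X] is the image of the condition for [A] at [g @` X]. *)
Lemma lebesgue_measurable_isometry (A : set R) :
  lebesgue_measurable A -> lebesgue_measurable (f @` A).
Proof.
rewrite (_ : @lebesgue_measurable R = caratheodory_measurable lambda)//.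
move=> mA X; rewrite -(image_canK f g X gK) !fE preimage_setC.
by rewrite -!preimage_setI -!fE !outer_measure_isometry; exact: mA.
Qed.

(** The set measured around [f p] is the image of the one measured around [p],
as [f] maps intervals centered at [p] onto intervals centered at [f p]. *)
Lemma density_ratio_isometry (s : R^nat) (A : set R) (p : R) :
  density_ratio s (f @` A) (f p) = density_ratio s A p.
Proof.
apply/funext => n; rewrite /density_ratio; congr (fine _ / _).
rewrite -image_itvcc_isometry !fE -preimage_setI -fE.
exact: outer_measure_isometry.
Qed.

Lemma density_topology_isometry (I : set (set nat)) (s : R^nat) (A : set R) :
  density_topology I s A -> density_topology I s (f @` A).
Proof.
move=> [mA Adense]; split; first exact: lebesgue_measurable_isometry.
move=> _ [p Ap <-]; rewrite /density_points/= /density_point.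
by rewrite density_ratio_isometry; exact: Adense.
Qed.

End isometry.

Theorem theorem4p11 (R : realType) (I : set (set nat))
  (I_ideal : is_ideal I) (I_nontrivial : nontrivial_ideal I)
  (I_admissible : admissible_ideal I)
  (s : R^nat) (s_Sigma : Sigma_ideal I s)
  (A : set R) (A_open : density_topology I s A) :
  (forall x : R, density_topology I s [set a + x | a in A]) /\
  density_topology I s [set - a | a in A].
Proof.
split=> [x|].
- apply: (@density_topology_isometry R (+%R^~ x) (+%R^~ (- x))) => //.
  + exact: addrK.
  + exact: subrK.
  + by move=> a b; rewrite opprD addrACA subrr addr0.
  + by move=> a b; rewrite opprD addrACA subrr addr0.
- apply: (@density_topology_isometry R -%R -%R) => //; try exact: opprK.
  + by move=> a b; rewrite -opprD normrN.
  + by move=> a b; rewrite -opprD normrN.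
Qed.
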